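(* There is no constant upper bound for the minimum absolute value of the entries of $\phi$; that is, for every natural number $N$ there exists a graph $G$ whose Seidel matrix is singular and such that every entry of $\phi(G)$ has absolute value greater than $N$.
   Context: All graphs are simple, undirected, finite, with at least one vertex. For a graph $G$ with vertices $v_1,\dots,v_n$ and adjacency matrix $A$, the Seidel matrix of $G$ is $S=J_n-I_n-2A$, where $J_n$ is the all-ones $n\times n$ matrix and $I_n$ the identity. It is known that $\operatorname{rank} S\ge n-1$ always. Hence, when $S$ is singular, its nullspace is one-dimensional, and $\phi=\phi(G)=\phi(S)$ denotes the unique integer vector $\phi\in\mathbb{Z}^n$ with $S\phi=0$, with the greatest common divisor of its entries equal to $1$, and with first non-zero entry positive. *)

(* Defs.v *)
From HB Require Import structures.
From mathcomp Require Import all_boot all_order all_algebra.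
Set Implicit Arguments.
Unset Strict Implicit.
Unset Printing Implicit Defensive.
Import Order.TTheory GRing.Theory Num.Theory.
Local Open Scope ring_scope.

Definition simple_graph (n : nat) (e : rel 'I_n) : Prop :=
  symmetric e /\ irreflexive e.

Definition adjacency (n : nat) (e : rel 'I_n) : 'M[int]_n :=
  \matrix_(i, j) (e i j)%:R.

Definition seidel (n : nat) (e : rel 'I_n) : 'M[int]_n :=
  const_mx 1 - 1%:M - 2%:R *: adjacency e.

Definition entries_gcd (n : nat) (v : 'cV[int]_n) : nat :=
  \big[gcdn/0%N]_(i < n) `|v i 0%R|%N.

Definition first_nonzero_pos (n : nat) (v : 'cV[int]_n) : bool :=
  [forall i : 'I_n,
    (v i 0 != 0) && [forall j : 'I_n, (j < i)%N ==> (v j 0 == 0)]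
      ==> (0 < v i 0)].

Definition is_phi (n : nat) (S : 'M[int]_n) (v : 'cV[int]_n) : bool :=
  [&& S *m v == 0, entries_gcd v == 1%N & first_nonzero_pos v].

Lemma gcd_dvd n (v : 'cV[int]_n) i : (entries_gcd v %| `|v i 0%R|)%N.
Proof. by rewrite /entries_gcd (bigD1 i) //= dvdn_gcdl. Qed.

Lemma dvd_gcd n (v : 'cV[int]_n) d :
  (forall i, (d %| `|v i 0%R|)%N) -> (d %| entries_gcd v)%N.
Proof.
move=> h; rewrite /entries_gcd; elim/big_ind: _ => //= x y hx hy.
by rewrite dvdn_gcd hx.
Qed.

Lemma gcd_eq0 n (v : 'cV[int]_n) : entries_gcd v = 0%N -> v = 0.
Proof.
move=> h; apply/colP=> i; have := gcd_dvd v i.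
by rewrite h dvd0n absz_eq0 mxE => /eqP.
Qed.

Lemma gcd_scale n (v : 'cV[int]_n) a :
  entries_gcd (a *: v) = (`|a| * entries_gcd v)%N.
Proof.
rewrite /entries_gcd (eq_bigr (fun i => `|a| * `|v i 0%R|)%N) => [|i _]; last first.
  by rewrite mxE abszM.
by elim/big_rec2: _ => [|i y1 y2 _ ->]; rewrite ?muln0 ?muln_gcdr.
Qed.

Lemma primitive_part n (v : 'cV[int]_n) : v != 0 ->
  exists d w, [/\ d != 0, v = d *: w & entries_gcd w == 1%N].
Proof.
move=> v0; have g0 : entries_gcd v != 0%N.
  by apply: contra v0 => /eqP/gcd_eq0 ->.
exists (Posz (entries_gcd v)), (\col_i (v i 0%R %/ (entries_gcd v)%:Z)%Z).
have E : v = (entries_gcd v)%:Z *: \col_i (v i 0%R %/ (entries_gcd v)%:Z)%Z.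
  apply/colP=> i; rewrite !mxE mulrC divzK //.
  by rewrite dvdzE gcd_dvd.
split=> //; move/(congr1 (@entries_gcd n)): E; rewrite gcd_scale /= -{1}[entries_gcd v]muln1.
by move/eqP; rewrite eqn_pmul2l ?lt0n // eq_sym.
Qed.

(* Modulo 2 the Seidel matrix is J - I, so the entries of v are all congruent
   to their sum, hence to each other. *)
Lemma seidel_kernel_odd n (e : rel 'I_n) (v : 'cV[int]_n) :
  seidel e *m v = 0 -> entries_gcd v == 1%N -> forall i, ~~ (2 %| `|v i 0%R|)%N.
Proof.
move=> Sv g1 i; apply/negP=> h.
pose s := \sum_j v j 0.
have key k : (2 %| s - v k 0%R)%Z.
  have := congr1 (fun M : 'cV[int]_n => M k 0) Sv; rewrite !mxE => E.
  have -> : s - v k 0 = 2%:Z * \sum_j adjacency e k j * v j 0.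
    apply: subr0_eq; apply: etrans E.
    rewrite mulr_sumr /s.
    have -> : v k 0 = \sum_j (k == j)%:R * v j 0.
      rewrite (bigD1 k) //= eqxx mul1r big1 ?addr0 // => j /negbTE.
      by rewrite eq_sym => ->; rewrite mul0r.
    rewrite -!sumrB; apply: eq_bigr => j _.
    by rewrite !mxE !mulrBl mul1r mulrA.
  by rewrite dvdz_mulr.
have hs : (2 %| s)%Z by rewrite -(subrK (v i 0) s) rpredD ?key ?dvdzE.
have : (2 %| entries_gcd v)%N.
  apply: dvd_gcd => k; rewrite -[2%N]/(absz 2) -dvdzE.
  by rewrite -(subKr s (v k 0)) rpredB.
by rewrite (eqP g1).
Qed.

Lemma scalez_col_eq0 n (a : int) (v : 'cV[int]_n) :
  (a *: v == 0) = (a == 0) || (v == 0).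
Proof.
apply/eqP/orP=> [/colP h|[]/eqP->]; rewrite ?scale0r ?scaler0 //.
case: (altP (a =P 0)) => [|a0]; [by left | right].
apply/eqP/colP=> i; move/eqP: (h i).
by rewrite !mxE mulf_eq0 (negbTE a0) => /eqP.
Qed.

Lemma first_nonzero n (v : 'cV[int]_n) : v != 0 ->
  exists2 i : 'I_n, v i 0 != 0 & forall j : 'I_n, (j < i)%N -> v j 0 = 0.
Proof.
move=> v0; have [i0 h0] : exists i, v i 0 != 0.
  apply/existsP; rewrite -negb_forall; apply: contra v0 => /forallP h.
  by apply/eqP/colP=> i; rewrite mxE (eqP (h i)).
case: (@arg_minnP _ i0 (fun i => v i 0 != 0) (@nat_of_ord n) h0) => i hi hm.
exists i => // j lt; apply/eqP; apply: contraTT lt => /hm.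
by rewrite -leqNgt.
Qed.

Lemma is_phi_exists n (S : 'M[int]_n) : \det S = 0 ->
  exists v, is_phi S v.
Proof.
move=> d0.
have [v v0 Sv] : exists2 v : 'cV[int]_n, v != 0 & S *m v = 0.
  have /det0P [u u0 hu] : \det (map_mx (intr : int -> rat) S^T) == 0.
    by rewrite det_map_mx det_tr d0 rmorph0.
  pose D := \prod_i denq (u 0 i).
  have D0 : D != 0 by apply/prodf_neq0 => i _; apply: denq_neq0.
  pose v : 'cV[int]_n := \col_i (numq (u 0 i) * \prod_(j | j != i) denq (u 0 j)).
  have E : map_mx (intr : int -> rat) v = D%:~R *: u^T.
    apply/colP=> i; rewrite !mxE /D [in RHS](bigD1 i) //= !intrM [RHS]mulrAC; congr (_ * _).
    by rewrite numqE mulrC.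
  exists v.
    apply: contra u0 => /eqP v0; move: E; rewrite v0 map_mx0 => /esym/eqP.
    by rewrite scaler_eq0 intr_eq0 (negbTE D0) trmx_eq0.
  suff : map_mx (intr : int -> rat) (S *m v) = 0.
    by move=> h; apply/colP=> k; move/colP/(_ k)/eqP: h; rewrite !mxE intr_eq0 => /eqP.
  rewrite map_mxM E -scalemxAr -[X in X *m _]trmxK -trmx_mul.
  by rewrite map_trmx hu trmx0 scaler0.
have [d [w [dn0 vE g1]]] := primitive_part v0.
have Sw : S *m w = 0.
  by apply/eqP; move/eqP: Sv; rewrite vE -scalemxAr scalez_col_eq0 (negbTE dn0).
have w0 : w != 0.
  by apply: contraTneq v0 => w0; rewrite vE w0 scaler0 eqxx.
have [i wi hi] := first_nonzero w0.
exists (Num.sg (w i 0) *: w); apply/and3P; split.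
- by rewrite -scalemxAr Sw scaler0.
- by rewrite gcd_scale (eqP g1) muln1 absz_sg wi.
apply/forallP=> k; apply/implyP=> /andP[wk /forallP hk].
have sn : Num.sg (w i 0) != 0 by rewrite sgr_eq0.
have -> : k = i.
  apply/val_inj; case: (ltngtP k i) => // lt.
    by move: wk; rewrite mxE (hi _ lt) mulr0 eqxx.
  by move: (hk i); rewrite lt mxE mulf_eq0 (negbTE sn) (negbTE wi).
by rewrite mxE -normrEsg normr_gt0.
Qed.

(* Every singular integer matrix admits a vector satisfying [is_phi]; by
   [is_phi_unique] it is the only one when the matrix is a Seidel matrix. *)
Definition phi (n : nat) (S : 'M[int]_n) (singS : \det S = 0) : 'cV[int]_n :=
  xchoose (is_phi_exists singS).

Lemma phiP n (S : 'M[int]_n) (singS : \det S = 0) : is_phi S (phi singS).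
Proof. exact: xchooseP. Qed.

Lemma is_phi_unique n (e : rel 'I_n) (v w : 'cV[int]_n) :
  is_phi (seidel e) v -> is_phi (seidel e) w -> v = w.
Proof.
move=> /and3P[/eqP Sv gv pv] /and3P[/eqP Sw gw pw].
have v0 : v != 0.
  by apply/eqP=> E; move: gv; rewrite E -(scale0r v) gcd_scale absz0 mul0n.
have [i vi hi] := first_nonzero v0.
have odd u : seidel e *m u = 0 -> entries_gcd u == 1%N ->
    forall k, u k 0 != 0.
  by move=> Su gu k; apply: contra (seidel_kernel_odd Su gu k) => /eqP->.
have i0 : i = 0%N :> nat.
  case: (posnP i) => // lt.
  pose z := Ordinal (leq_ltn_trans (leq0n i) (ltn_ord i)).
  by have := odd v Sv gv z; rewrite hi ?eqxx.
have pos u : seidel e *m u = 0 -> entries_gcd u == 1%N ->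
    first_nonzero_pos u -> 0 < u i 0.
  move=> Su gu /forallP /(_ i) /implyP; apply; rewrite odd //=.
  by apply/forallP=> j; rewrite i0 ltn0.
have vp := pos _ Sv gv pv; have wp := pos _ Sw gw pw.
have E : w i 0 *: v = v i 0 *: w.
  apply/eqP; rewrite -subr_eq0; apply: contraTT isT => /primitive_part.
  move=> [d [x [d0 xE gx]]].
  have Sx : seidel e *m x = 0.
    apply/eqP; have : seidel e *m (w i 0 *: v - v i 0 *: w) == 0.
      by rewrite mulmxBr -!scalemxAr Sv Sw !scaler0 subr0.
    by rewrite xE -scalemxAr scalez_col_eq0 (negbTE d0).
  have := congr1 (fun M : 'cV[int]_n => M i 0) xE; rewrite !mxE mulrC subrr.
  by move/esym/eqP; rewrite mulf_eq0 (negbTE d0) (negbTE (odd _ Sx gx i)).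
have vw : v i 0 = w i 0.
  have := congr1 (@entries_gcd n) E; rewrite !gcd_scale (eqP gv) (eqP gw) !muln1.
  by move/(congr1 Posz); rewrite !gtz0_abs // => ->.
by move/eqP: E; rewrite vw -subr_eq0 -scalerBr scalez_col_eq0 gt_eqF //= subr_eq0 => /eqP.
Qed.

(* Main.v *)
(** The vertices split into two sets [A0], [A1] of size [4k] and a set [B] of
    size [4k+1]; the kernel vector is [4k+1] on [A0] and [A1], and [4k-1] on
    [B].  In terms of Seidel signs ([-1] for an edge), [A0] is all [+1], [A1]
    is all [-1], the signs between [A0] and [A1] form a checkerboard with zero
    row and column sums, [B] is joined by [-1] to [A0] and by [+1] to [A1], and
    the signs inside [B] have zero row sums.  A vertex of [A0] thus sees
    [(4k-1)(4k+1) - (4k+1)(4k-1) = 0], a vertex of [A1] the opposite, and for a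
    vertex of [B] the contributions of [A0] and [A1] cancel.  The two values
    are odd and differ by 2, hence are coprime. *)

Require Import Defs.
From mathcomp Require Import all_boot all_order all_algebra.
From mathcomp Require Import zify ring.
Import Order.TTheory GRing.Theory Num.Theory.
Local Open Scope ring_scope.

(* The diagonal term of the sum is [w x], since [r] is irreflexive. *)
Definition seidel_null (T : finType) (r : rel T) (w : T -> int) : Prop :=
  forall x, \sum_y (-1) ^+ r x y * w y = w x.

Definition enum_rel (T : finType) (r : rel T) : rel 'I_#|T| :=
  fun i j => r (enum_val i) (enum_val j).

Lemma seidel_enum_null (T : finType) (r : rel T) (w : T -> int) :
  seidel_null T r w ->
  seidel (enum_rel T r) *m (\col_i w (enum_val i)) = 0.
Proof.
move=> rw; apply/colP=> i; rewrite !mxE.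
transitivity (\sum_(y : T) (-1) ^+ r (enum_val i) y * w y - w (enum_val i));
  last by rewrite rw subrr.
rewrite (reindex (@enum_val T T)) /=; last exact: onW_bij (enum_val_bij T).
have -> : w (enum_val i) = \sum_j (i == j)%:R * w (enum_val j).
  rewrite (bigD1 i) //= eqxx mul1r big1 ?addr0 // => j /negbTE.
  by rewrite eq_sym => ->; rewrite mul0r.
rewrite -sumrB; apply: eq_bigr => j _.
by rewrite !mxE /enum_rel; case: (r _ _); case: (i == j) => /=; ring.
Qed.

(** Multiplying by the adjugate gives [\det S *: v = 0], and [int] has no zero divisors. *)
Lemma det_kernel_eq0 n (S : 'M[int]_n) (v : 'cV[int]_n) i :
  S *m v = 0 -> v i 0 != 0 -> \det S = 0.
Proof.
move=> Sv vi.
have : (\adj S *m S) *m v = 0 by rewrite -mulmxA Sv mulmx0.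
rewrite mul_adj_mx mul_scalar_mx => /colP/(_ i)/eqP.
by rewrite !mxE mulf_eq0 (negbTE vi) orbF => /eqP.
Qed.

Lemma phi_enum (T : finType) (r : rel T) (w : T -> int) (x y : T) :
  seidel_null T r w -> (forall z, 0 < w z) -> coprime `|w x| `|w y| ->
  exists singS : \det (seidel (enum_rel T r)) = 0,
    forall i, phi singS i 0 = w (enum_val i).
Proof.
move=> rw wpos cop; pose v : 'cV[int]_#|T| := \col_i w (enum_val i).
have Sv : seidel (enum_rel T r) *m v = 0 by exact: seidel_enum_null.
have singS : \det (seidel (enum_rel T r)) = 0.
  by apply: (det_kernel_eq0 _ _ _ (enum_rank x) Sv); rewrite mxE gt_eqF.
exists singS => i; suff -> : phi singS = v by rewrite mxE.
apply: is_phi_unique; first exact: phiP.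
apply/and3P; split; first by rewrite Sv.
  (* The gcd of all entries divides the two coprime ones, at [x] and [y]. *)
  rewrite -dvdn1 -(eqP cop) dvdn_gcd.
  have := gcd_dvd v (enum_rank x); rewrite mxE enum_rankK => ->.
  by have := gcd_dvd v (enum_rank y); rewrite mxE enum_rankK => ->.
by apply/forallP=> j; apply/implyP=> _; rewrite mxE.
Qed.

Lemma sum_option (T : finType) (R : nmodType) (F : option T -> R) :
  \sum_y F y = F None + \sum_y F (Some y).
Proof.
rewrite ![index_enum _]unlock [@Finite.enum in LHS]unlock /=.
by rewrite big_cons big_map.
Qed.

Section Witness.
Variable k : nat.

(* [inl (h, _)] ranges over [A0] ([h = false]) and [A1] ([h = true]), the
   second boolean being the colour of the checkerboard.  Inside [B], [inr None]
   is an apex over [2k] pairs [inr (Some (c, _, _))]: the sign between two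
   pairs is the product of the signs of their members, so it sums to zero over
   each pair, while the sign within a pair is opposite to that of its two links
   to the apex; this sign depends on [c]. *)
Definition vertex : finType :=
  ((bool * (bool * 'I_k.*2)) + option ((bool * 'I_k) * bool))%type.

Definition edge : rel vertex := fun x y =>
  match x, y with
  | inl (h, x'), inl (h', y') =>
      if h == h' then h && (x' != y') else x'.1 (+) y'.1
  | inl (h, _), inr _ | inr _, inl (h, _) => ~~ h
  | inr None, inr None => false
  | inr None, inr (Some (p, _)) | inr (Some (p, _)), inr None => p.1
  | inr (Some (p, s)), inr (Some (p', s')) =>
      ((p != p') || ~~ p.1) && (s (+) s')
  end.

Definition weight (x : vertex) : int :=
  if x is inl _ then (4 * k)%:Z + 1 else (4 * k)%:Z - 1.

Lemma edge_sym : symmetric edge.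
Proof.
case=> [[h x]|[[p s]|]] [[h' y]|[[p' s']|]] //=.
  by rewrite eq_sym [x == y]eq_sym addbC; case: eqP => // ->.
by rewrite eq_sym addbC; case: eqP => // ->.
Qed.

Lemma edge_irr : irreflexive edge.
Proof. by case=> [[h x]|[[p s]|]] //=; rewrite ?eqxx ?addbb ?andbF. Qed.

Lemma sum_sign_cross (b : bool) :
  \sum_(y : bool * 'I_k.*2) (-1) ^+ (b (+) y.1) = 0 :> int.
Proof.
rewrite -(pair_bigA _ (fun c _ => (-1) ^+ (b (+) c))) /= big_bool /=.
by rewrite !sumr_const card_ord; case: b => /=; ring.
Qed.

Lemma card_half : #|{: bool * 'I_k.*2}| = (4 * k)%N.
Proof. by rewrite card_prod card_bool card_ord; lia. Qed.

Lemma card_pairs : #|{: (bool * 'I_k) * bool}| = (4 * k)%N.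
Proof. by rewrite !card_prod card_bool card_ord; lia. Qed.

Lemma sum_sign_neq (x : bool * 'I_k.*2) :
  \sum_y (-1) ^+ (x != y) = 2 - (4 * k)%:Z :> int.
Proof.
have : \sum_(y : bool * 'I_k.*2) (-1 : int) = - (4 * k)%:Z.
  by rewrite sumr_const card_half; lia.
rewrite (bigD1 x) //= => E; rewrite (bigD1 x) //= eqxx expr0.
rewrite (eq_bigr (fun=> -1)) => [|y]; first by rewrite (canRL (addKr _) E); ring.
by rewrite [y == x]eq_sym => ->.
Qed.

Lemma sum_sign_apex :
  \sum_(y : (bool * 'I_k) * bool) (-1) ^+ y.1.1 = 0 :> int.
Proof.
rewrite -(pair_bigA _ (fun (p : bool * 'I_k) _ => (-1) ^+ p.1)) /=.
under eq_bigr do rewrite big_bool.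
rewrite -(pair_bigA _ (fun (c : bool) _ => (-1) ^+ c + (-1) ^+ c)) /= big_bool /=.
by rewrite !sumr_const; ring.
Qed.

(** Pairs other than [p] cancel. Adding the apex sign [(-1) ^+ p.1] makes the row total inside [B]
    equal to 1, the diagonal term. *)
Lemma sum_sign_pairs (p : bool * 'I_k) (s : bool) :
  \sum_(y : (bool * 'I_k) * bool)
    (-1) ^+ (((p != y.1) || ~~ p.1) && (s (+) y.2)) = 1 - (-1) ^+ p.1 :> int.
Proof.
rewrite -(pair_bigA _ (fun p' s' =>
  (-1) ^+ (((p != p') || ~~ p.1) && (s (+) s')))) /=.
rewrite (bigD1 p) //= [X in _ + X]big1 => [|p' ne].
  by rewrite big_bool eqxx; case: (p.1); case: s.
by rewrite big_bool /= eq_sym ne; case: s.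
Qed.

Lemma edge_null : seidel_null vertex edge weight.
Proof.
(* The weight is constant on each summand of [vertex], so only sums of signs remain. *)
move=> x; rewrite big_sumType /= -!mulr_suml.
have -> : \sum_i (-1) ^+ edge x (inl i) =
    \sum_(h : bool) \sum_y (-1) ^+ edge x (inl (h, y)) :> int.
  by rewrite pair_bigA; apply: eq_bigr => -[].
rewrite sum_option big_bool /=.
case: x => [[h x]|[[p s]|]] /=.
- case: h => /=.
    by rewrite sum_sign_neq sum_sign_cross sumr_const card_pairs; ring.
  by rewrite sum_sign_cross !sumr_const card_half card_pairs; ring.
- rewrite !sumr_const card_half.
  rewrite (eq_bigr (fun y => (-1) ^+ (((p != y.1) || ~~ p.1) && (s (+) y.2))));
    last by case.
  by rewrite sum_sign_pairs; ring.
rewrite !sumr_const card_half.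
rewrite (eq_bigr (fun y : (bool * 'I_k) * bool => (-1) ^+ y.1.1));
  last by case.
by rewrite sum_sign_apex; ring.
Qed.

End Witness.

Theorem theorem4p3 (N : nat) :
  exists (n : nat) (e : rel 'I_n),
    [/\ (0 < n)%N, simple_graph e &
        exists singS : \det (seidel e) = 0,
          forall i : 'I_n, N%:Z < `|phi singS i 0| ].
Proof.
(* The smaller weight [4k - 1] becomes [4N + 3], which exceeds [N]. *)
pose k := N.+1; pose V := vertex k; pose r := edge k.
have k2 : (0 < k.*2)%N by [].
pose a : V := inl (true, (true, Ordinal k2)); pose b : V := inr None.
have cop : coprime `|weight k a| `|weight k b|.
  have -> : `|weight k a|%N = (4 * N + 3 + 2)%N by rewrite /= /k; lia.
  have -> : `|weight k b|%N = (4 * N + 3)%N by rewrite /= /k; lia.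
  by rewrite /coprime gcdnC gcdnDl -/(coprime _ 2) coprimen2; lia.
have wN x : N%:Z < weight k x by case: x => ? /=; rewrite /k; lia.
have wpos x : 0 < weight k x by have := wN x; lia.
have [singS phiE] := phi_enum _ _ _ _ _ (edge_null k) wpos cop.
exists #|V|, (enum_rel V r); split.
- by apply/card_gt0P; exists b.
- split=> [i j|i]; [exact: edge_sym | exact: edge_irr].
by exists singS => i; rewrite phiE gtr0_norm.
Qed.
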